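(* Let $M_c$ be a melon graph that is a comparability graph. If all the constituent paths of $M_c$ are of odd length and of length at least three, then $\mathcal{R}^p(M_c)\le 3$.
   Context: All graphs are finite and simple. A melon graph $M=(E_1,\ldots,E_m)$ ($m\ge 1$) is the graph formed as the union of $m$ paths $E_1,\ldots,E_m$ (the constituent paths), all having the same two distinct endpoints $0$ and $0'$, and pairwise sharing no vertices other than $0$ and $0'$; since $M$ is simple, at most one constituent path has length one (length = number of edges). A comparability graph is a graph admitting a transitive orientation. Two letters $a\neq b$ alternate in a word $w$ if the subword of $w$ consisting of all occurrences of $a$ and $b$ is of the form $abab\cdots$ or $baba\cdots$. A word $w$ represents a graph $G=(V,E)$ if for all distinct $a,b\in V$: $\{a,b\}\in E$ if and only if $a$ and $b$ alternate in $w$. $G$ is permutationally $k$-representable if it is represented by a word $p_1p_2\cdots p_k$ where each $p_i$ is a permutation of $V$ (a word containing each vertex exactly once); such a $k$ exists exactly for comparability graphs. The permutation-representation number $\mathcal{R}^p(G)$ of a comparability graph $G$ is the smallest such $k$. *)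

(* Defs.v *)
From mathcomp Require Import all_boot.
Set Implicit Arguments.
Unset Strict Implicit.
Unset Printing Implicit Defensive.

Record sgraph := SGraph {
  vertex :> finType;
  edge : rel vertex;
  edge_sym : symmetric edge;
  edge_irrefl : irreflexive edge
}.

Definition transitive_orientation (G : sgraph) (o : rel G) : Prop :=
  [/\ forall x y, edge x y = o x y || o y x,
      forall x y, o x y -> ~~ o y x
    & transitive o].

Definition comparability (G : sgraph) : Prop :=
  exists o : rel G, transitive_orientation o.

Section Paths.
Variable T : eqType.

(* A path is given by the sequence of all its vertices, endpoints included. *)
Definition path_length (s : seq T) : nat := (size s).-1.

Definition path_edge (s : seq T) (x y : T) : bool :=
  ((x, y) \in zip s (behead s)) || ((y, x) \in zip s (behead s)).

Definition is_path_between (x y : T) (s : seq T) : Prop :=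
  uniq s /\ exists p, s = x :: rcons p y.

End Paths.

(* [melon z z' E]: G is the melon graph with constituent paths [E i] and
   common endpoints z (the vertex 0) and z' (the vertex 0'). *)
Record melon (G : sgraph) (z z' : G) (m : nat) (E : 'I_m -> seq G) : Prop :=
  Melon {
    melon_nonempty : 0 < m;
    melon_ends : z != z';
    melon_path : forall i, is_path_between z z' (E i);
    melon_disjoint : forall i j x, i != j ->
      x \in E i -> x \in E j -> x = z \/ x = z';
    melon_vertex : forall x, exists i, x \in E i;
    melon_edge : forall x y, edge x y = [exists i, path_edge (E i) x y];
    melon_short : forall i j,
      path_length (E i) = 1 -> path_length (E j) = 1 -> i = j
  }.

Section Words.
Variable T : eqType.

(* the word abab... with n letters *)
Definition alt_word (a b : T) (n : nat) : seq T :=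
  mkseq (fun i => if odd i then b else a) n.

Definition alternate (a b : T) (w : seq T) : Prop :=
  exists n, [seq x <- w | (x == a) || (x == b)] = alt_word a b n \/
            [seq x <- w | (x == a) || (x == b)] = alt_word b a n.

End Words.

Definition represents (G : sgraph) (w : seq G) : Prop :=
  forall a b : G, a != b -> (edge a b <-> alternate a b w).

Definition perm_representable (G : sgraph) (k : nat) : Prop :=
  exists ps : k.-tuple (seq G),
    (forall i, perm_eq (tnth ps i) (enum G)) /\ represents (flatten ps).

(* R^p(G) = k.  The minimum is over k > 0: the empty product of permutations
   would vacuously represent every complete graph. *)
Definition perm_rep_number (G : sgraph) (k : nat) : Prop :=
  [/\ 0 < k, perm_representable G k
    & forall j, 0 < j -> perm_representable G j -> k <= j].

(* Main.v *)
Require Import Defs.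
From Stdlib Require Import Classical.
From mathcomp Require Import all_boot.
From mathcomp Require Import zify.

(** Two letters alternate in a product of permutations exactly when they occur
    in the same order in each factor.  So the task is to find three rankings of
    the vertices such that adjacent vertices are ranked the same way by all
    three, while every ordered pair (x, y) of distinct nonadjacent vertices has
    x ranked before y by at least one of them ([perm_representable_ranks]).

    Since all paths have odd length, the vertices at even positions on their
    path form one side of a bipartition, with z among them, and those at odd
    positions the other side, with z' among them.  In every ranking an
    even vertex comes before its (odd) neighbours.

    Without z and z' the graph is a disjoint union of paths, for which two
    rankings suffice.  The first lists the paths one after the other, each along
    its direction as v2 v1 v4 v3 v6 v5 ...; the second lists the paths in the
    opposite order, each backwards as v_n v_(n-2) v_(n-1) ... v2 v3 v1 with n
    even, so that even vertices still precede their neighbours.  Any two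
    nonadjacent inner vertices are ranked one way by the first and the other way
    by the second.

    Both rankings can be completed by putting z first and z' last.  What then
    remains is to rank z after all its non-neighbours and z' before all its
    non-neighbours, and a single third ranking does both: the neighbours of z',
    then z', then the remaining even inner vertices, the remaining odd ones, then
    z, then the neighbours of z.  It is compatible with the edges because a
    neighbour of z' is even, a neighbour of z is odd, and, the lengths being at
    least three, z and z' are not adjacent. *)

Set Implicit Arguments.
Unset Strict Implicit.
Unset Printing Implicit Defensive.

(** * Words built from rankings *)

Section Words.
Variable T : eqType.
Implicit Types (a b : T) (s : seq T) (ss : seq (seq T)).

Lemma alt_wordS a b n : alt_word a b n.+1 = a :: alt_word b a n.
Proof.
rewrite /alt_word /mkseq /= -[1]addn0 iotaDl -map_comp.
by congr cons; apply: eq_map => i /=; case: (odd i).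
Qed.

Lemma flatten_alt_word a b ss :
  all (pred1 [:: a; b]) ss -> flatten ss = alt_word a b (size ss).*2.
Proof.
elim: ss => //= s ss IH /andP[/eqP-> /IH->].
by rewrite doubleS !alt_wordS.
Qed.

(** Two letters of an alternating word determine the phase, so after a first block
    ab the rest of the word starts with a again. *)
Lemma alt_word_flatten a b ss n :
  a != b -> all [in [:: [:: a; b]; [:: b; a]]] ss ->
  flatten ss = alt_word a b n -> all (pred1 [:: a; b]) ss.
Proof.
move=> ab; elim: ss n => //= s ss IH n /andP[].
rewrite !inE => /orP[] /eqP->; rewrite /= ?eqxx /=.
- by case: n => [|[|n]] // ssP; rewrite !alt_wordS => -[/(IH n ssP)].
- by case: n => [|n] // _; rewrite alt_wordS => -[ba]; rewrite ba eqxx in ab.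
Qed.

Lemma filter_pair a b s : a != b -> uniq s -> a \in s -> b \in s ->
  [seq x <- s | (x == a) || (x == b)] \in [:: [:: a; b]; [:: b; a]].
Proof.
move=> ab s_uniq a_s b_s; set t := filter _ _.
have tP: perm_eq t [:: a; b].
  apply: uniq_perm; rewrite ?filter_uniq //= ?inE ?ab // => x.
  by rewrite mem_filter !inE; case: eqP => [->|_]; rewrite ?a_s //;
     case: eqP => [->|].
have t_uniq: uniq t by rewrite filter_uniq.
have t_sub: {subset t <= [:: a; b]} by move=> x; rewrite (perm_mem tP).
move: t t_uniq t_sub {tP}(perm_size tP) => [|c [|d []]] //= + cd_sub _.
have := cd_sub c; have := cd_sub d; rewrite !inE !eqxx orbT.
by move=> /(_ isT)/orP[]/eqP-> /(_ isT)/orP[]/eqP->; rewrite !eqxx ?orbT.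
Qed.

End Words.

Section Ranks.
Variable G : sgraph.
Implicit Types (r : G -> nat) (a b : G).

Definition rank_word r : seq G := sort (relpre r leq) (enum G).

Definition rank_pair a b r : seq G :=
  [seq x <- rank_word r | (x == a) || (x == b)].

Lemma rank_pair_or a b r :
  a != b -> rank_pair a b r \in [:: [:: a; b]; [:: b; a]].
Proof.
by move=> ab; apply: filter_pair; rewrite ?sort_uniq ?enum_uniq ?mem_sort ?mem_enum.
Qed.

Lemma rank_pairE a b r : r a < r b -> rank_pair a b r = [:: a; b].
Proof.
move=> rab; have ab: a != b by apply: contraTneq rab => ->; rewrite ltnn.
have: sorted (relpre r leq) (rank_pair a b r).
  apply: sorted_filter => [y x z|]; first exact: leq_trans.
  by apply: sort_sorted => x y; exact: leq_total.
have := rank_pair_or r ab; rewrite !inE => /orP[] /eqP-> //=.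
by rewrite leqNgt rab.
Qed.

Lemma rank_pairC a b r : rank_pair a b r = rank_pair b a r.
Proof. by apply: eq_filter => x; rewrite orbC. Qed.

(** Ties are harmless: the sorting breaks them in some way, and the hypotheses
    only speak of strict inequalities.  The second hypothesis, applied to both
    (a, b) and (b, a), yields two permutations that disagree on a and b. *)
Lemma perm_representable_ranks k (r : 'I_k -> G -> nat) :
  (forall a b, edge a b ->
     (forall t, r t a < r t b) \/ (forall t, r t b < r t a)) ->
  (forall a b, a != b -> ~~ edge a b -> exists t, r t a < r t b) ->
  perm_representable G k.
Proof.
move=> r_edge r_nonedge.
exists [tuple rank_word (r t) | t < k]; split=> [t|a b ab].
  by rewrite tnth_mktuple perm_sort.
pose pairs c d := [seq rank_pair c d (r t) | t <- enum 'I_k].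
have wordE: [seq x <- flatten [tuple rank_word (r t) | t < k]
                | (x == a) || (x == b)] = flatten (pairs a b).
  by rewrite filter_flatten -map_comp.
have lt_all c d: (forall t, r t c < r t d) -> all (pred1 [:: c; d]) (pairs c d).
  by move=> rcd; rewrite all_map; apply/allP => t _ /=; rewrite rank_pairE.
have nonalt c d n t: c != d -> flatten (pairs c d) = alt_word c d n ->
    r t d < r t c -> False.
  move=> cd /(alt_word_flatten cd) all1 /rank_pairE tE.
  have: all (pred1 [:: c; d]) (pairs c d).
    by apply: all1; rewrite all_map; apply/allP => u _; exact: rank_pair_or.
  rewrite all_map => /allP/(_ t (mem_enum _ t))/=.
  by rewrite rank_pairC tE => /eqP[dc]; rewrite dc eqxx in cd.
have pairsC: pairs a b = pairs b a by apply: eq_map => t; exact: rank_pairC.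
rewrite /alternate wordE; split=> [/r_edge[]/lt_all all_lt|[n wE]].
- by eexists; left; exact: flatten_alt_word all_lt.
- by eexists; right; rewrite pairsC; exact: flatten_alt_word all_lt.
apply: contraT => Nab; have ba: b != a by rewrite eq_sym.
have Nba: ~~ edge b a by rewrite edge_sym.
have [t rab] := r_nonedge _ _ ab Nab; have [u rba] := r_nonedge _ _ ba Nba.
case: wE => wE; first by case: (nonalt a b n u).
by rewrite pairsC in wE; case: (nonalt b a n t).
Qed.

End Ranks.

(** Representability by k permutations is a mere proposition, so the least k is
    found by classical strong induction. *)
Lemma perm_rep_number_le (G : sgraph) k :
  0 < k -> perm_representable G k -> exists j, perm_rep_number G j /\ j <= k.
Proof.
elim/ltn_ind: k => k IH k_gt0 Gk.
have [[j [jk j_gt0 Gj]]|no_smaller] :=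
    classic (exists j, [/\ j < k, 0 < j & perm_representable G j]).
  have [i [Gi ij]] := IH j jk j_gt0 Gj.
  by exists i; split=> //; exact: leq_trans (ltnW jk).
exists k; split=> //; split=> // j j_gt0 Gj; rewrite leqNgt; apply/negP => jk.
by apply: no_smaller; exists j.
Qed.

(** * Coordinates on a melon graph *)

Section Melon.
Variables (G : sgraph) (z z' : G) (m : nat) (E : 'I_m -> seq G).
Hypothesis GE : melon z z' E.

Definition len i := path_length (E i).

Lemma melon_nthP i : [/\ size (E i) = (len i).+1, uniq (E i),
  nth z (E i) 0 = z & nth z (E i) (len i) = z'].
Proof.
rewrite /len /path_length.
have [E_uniq [p EE]] := melon_path GE i.
by split; rewrite // EE //= size_rcons //= nth_rcons ltnn eqxx.
Qed.

Definition path_of (x : G) : 'I_m :=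
  xchoose (melon_vertex GE x).

Definition pos (x : G) : nat := index x (E (path_of x)).

Lemma mem_path_of x : x \in E (path_of x).
Proof. exact: xchooseP (melon_vertex GE x). Qed.

Lemma nth_pos x : nth z (E (path_of x)) (pos x) = x.
Proof. by rewrite nth_index // mem_path_of. Qed.

Lemma pos_le x : pos x <= len (path_of x).
Proof.
have [sz _ _ _] := melon_nthP (path_of x).
by rewrite -ltnS -sz index_mem mem_path_of.
Qed.

(** The common endpoints lie on every path, so the path chosen for them is
    arbitrary; a function of the coordinates is well defined on vertices as soon
    as it ignores the path at both ends. *)
Lemma coordP i p (x := nth z (E i) p) : p <= len i ->
  [\/ path_of x = i /\ pos x = p, p = 0 /\ pos x = 0
    | p = len i /\ pos x = len (path_of x)].
Proof.
move=> pi; have [sz E_uniq E0 El] := melon_nthP i.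
have [sz' E_uniq' E0' El'] := melon_nthP (path_of x).
have xE: x \in E i by rewrite mem_nth // sz.
have [ei|ni] := eqVneq (path_of x) i.
  by constructor 1; split=> //; rewrite /pos ei index_uniq // sz.
have posE q : q <= len (path_of x) -> nth z (E (path_of x)) q = x -> pos x = q.
  by move=> lq xq; rewrite /pos -{1}xq index_uniq // sz'.
have pE q : q <= len i -> nth z (E i) q = x -> p = q.
  move=> lq xq; apply/eqP; rewrite -(nth_uniq z _ _ E_uniq) ?sz //.
  by rewrite xq.
case: (melon_disjoint GE ni (mem_path_of x) xE) => xz.
- by constructor 2; split; [apply: pE | apply: posE]; rewrite // ?E0 ?E0'.
- by constructor 3; split; [apply: pE | apply: posE]; rewrite // ?El ?El'.
Qed.

Lemma edge_coord x y : edge x y -> exists i p, p < len i /\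
  ((x = nth z (E i) p /\ y = nth z (E i) p.+1) \/
   (y = nth z (E i) p /\ x = nth z (E i) p.+1)).
Proof.
rewrite (melon_edge GE) => /existsP[i xyE]; exists i.
have [sz _ _ _] := melon_nthP i.
have zipP u v : (u, v) \in zip (E i) (behead (E i)) ->
    exists p, [/\ p < len i, u = nth z (E i) p & v = nth z (E i) p.+1].
  move=> /(nthP (z, z))[p]; rewrite size_zip size_behead sz /= => p_lt.
  rewrite nth_zip_cond size_zip size_behead sz /= p_lt nth_behead => -[<- <-].
  by exists p; split=> //; lia.
by case/orP: xyE => /zipP[p [pi -> ->]]; exists p; split; auto.
Qed.

Lemma coord_edge i p : p < len i -> edge (nth z (E i) p) (nth z (E i) p.+1).
Proof.
move=> pi; rewrite (melon_edge GE); apply/existsP; exists i.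
have [sz _ _ _] := melon_nthP i.
have szip: size (zip (E i) (behead (E i))) = len i.
  by rewrite size_zip size_behead sz /=; lia.
apply/orP; left; apply/(nthP (z, z)); exists p; first by rewrite szip.
by rewrite nth_zip_cond szip pi nth_behead.
Qed.

(** * The three rankings *)

Hypothesis odd_len : forall i, odd (len i).
Hypothesis long_len : forall i, 3 <= len i.

(** Swapping 2k-1 with 2k puts even vertices before their neighbours when paths
    are read forwards; swapping 2k with 2k+1 does it when they are read
    backwards, in order of decreasing [back]. *)
Definition forw p := if odd p then p.+1 else p.-1.
Definition back p := if odd p then p.-1 else p.+1.

(** Larger than every value of [forw] and [back] at an inner position, so that
    distinct paths get disjoint intervals of ranks; the rank m.+1 * width given
    to z' lies beyond all of them. *)
Definition width := #|G|.+2.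

Definition rank_forw (i : 'I_m) p :=
  if p == 0 then 0 else if p == len i then m.+1 * width else i * width + forw p.

Definition rank_back (i : 'I_m) p :=
  if p == 0 then 0 else if p == len i then m.+1 * width
  else (m - i) * width - back p.

Definition rank_ends (i : 'I_m) p :=
  if p == 0 then 4 else if p == len i then 1
  else if p == 1 then 5 else if p == (len i).-1 then 0
  else if odd p then 3 else 2.

Definition rank_coord (t : 'I_3) : 'I_m -> nat -> nat :=
  match val t with 0 => rank_forw | 1 => rank_back | _ => rank_ends end.

Definition rank t (x : G) : nat := rank_coord t (path_of x) (pos x).

Lemma len_width i : (len i).+2 < width.
Proof.
have [sz E_uniq _ _] := melon_nthP i.
by rewrite /width ltnS ltnS -sz -(card_uniqP E_uniq) max_card.
Qed.

(** No ranking distinguishes the copies of z, or those of z', on the various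
    paths, so a vertex may be ranked along any path through it. *)
Lemma rank_nth t i p : p <= len i -> rank t (nth z (E i) p) = rank_coord t i p.
Proof.
have len0 j : (len j == 0) = false by have := long_len j; case: (len j).
rewrite /rank => /coordP[[-> ->]//|[-> ->]|[-> ->]];
by case: t => [[|[|t]] lt];
   rewrite /rank_coord /= /rank_forw /rank_back /rank_ends ?eqxx ?len0.
Qed.

Lemma block_lt i j a b : i < j -> a < width -> i * width + a < j * width + b.
Proof. by move=> ij aw; have := leq_mul ij (leqnn width); lia. Qed.

Lemma rank_coord_edge t i p q :
  ~~ odd p -> odd q -> p <= len i -> q <= len i -> p = q.+1 \/ q = p.+1 ->
  rank_coord t i p < rank_coord t i q.
Proof.
move=> p_even q_odd pi qi pq.
have := odd_len i; have := long_len i; have := len_width i; have := ltn_ord i.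
move=> im lw l3 lo.
have blk: i.+1 * width <= m * width by rewrite leq_mul2r im orbT.
have blk': 1 * width <= (m - i) * width by rewrite leq_mul2r; lia.
have blk'' : (m - i) * width <= m * width by rewrite leq_mul2r; lia.
case: t => [[|[|t]] lt]; rewrite /rank_coord /=.
- rewrite /rank_forw /forw (negPf p_even) q_odd.
  by do !case: eqP => ?; lia.
- rewrite /rank_back /back (negPf p_even) q_odd.
  by do !case: eqP => ?; lia.
- rewrite /rank_ends (negPf p_even) q_odd.
  by do !case: eqP => ?; lia.
Qed.

Lemma rank_edge a b : edge a b ->
  (forall t, rank t a < rank t b) \/ (forall t, rank t b < rank t a).
Proof.
case/edge_coord=> i [p [pi [[-> ->]|[-> ->]]]];
have [p_odd|p_even] := boolP (odd p); [right|left|left|right] => t;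
by rewrite !rank_nth ?rank_coord_edge //=; rewrite ?p_odd //; lia.
Qed.

(** The hypotheses are what nonadjacency and distinctness give on coordinates:
    q = 0 means that the second vertex is z, and p = len i that the first one is
    z'.  These are the two cases settled by the third ranking. *)
Lemma rank_coord_nonedge i j p q : p <= len i -> q <= len j ->
  (q = 0 -> 1 < p) -> (p = len i -> q < (len j).-1) ->
  (i = j -> p.+1 < q \/ q.+1 < p) ->
  exists t, rank_coord t i p < rank_coord t j q.
Proof.
move=> pi qj Hq Hp Hij.
have := odd_len i; have := long_len i; have := len_width i.
have := odd_len j; have := long_len j; have := len_width j.
move=> jw j3 jo iw i3 io.
have blk: i.+1 * width <= m * width by rewrite leq_mul2r ltn_ord orbT.
have blk': 1 * width <= (m - j) * width.
  by rewrite leq_mul2r; have := ltn_ord j; lia.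
suff: [\/ rank_forw i p < rank_forw j q, rank_back i p < rank_back j q
        | rank_ends i p < rank_ends j q].
  by case=> lt; [exists (@Ordinal 3 0 isT)|exists (@Ordinal 3 1 isT)
                |exists (@Ordinal 3 2 isT)].
(* The first vertex is z, or the second one is z'. *)
have [p0|p0] := eqVneq p 0.
  by constructor 1; rewrite /rank_forw p0 /forw /=; do !case: ifP => ?; lia.
have [ql|ql] := eqVneq q (len j).
  by constructor 1; rewrite /rank_forw /forw ql eqxx; do !case: ifP => ?; lia.
have [q0|q0] := eqVneq q 0.
  have {}Hq := Hq q0.
  by constructor 3; rewrite /rank_ends q0 /=; do !case: ifP => ?; lia.
have [pl|pl] := eqVneq p (len i).
  have {}Hp := Hp pl.
  by constructor 3; rewrite /rank_ends pl eqxx; do !case: ifP => ?; lia.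
(* Both vertices are inner: whichever comes first, path by path and then along
   the path, the two rankings by blocks disagree on them. *)
rewrite /rank_forw /rank_back (negPf p0) (negPf pl) (negPf q0) (negPf ql).
have fw: forw p < width by rewrite /forw; case: ifP; lia.
have bw: back q < width by rewrite /back; case: ifP; lia.
have [ij|ji|/val_inj eij] := ltngtP i j.
- by constructor 1; apply: block_lt.
- constructor 2.
  have: (m - i).+1 * width <= (m - j) * width.
    by rewrite leq_mul2r; have := ltn_ord i; lia.
  have: 1 * width <= (m - i) * width.
    by rewrite leq_mul2r; have := ltn_ord i; lia.
  lia.
have [{}Hij|{}Hij] := Hij eij; subst j.
- by constructor 1; rewrite ltn_add2l /forw; do 2 case: ifP; lia.
- constructor 2; rewrite /back; move: bw; rewrite /back.
  by do 2 case: ifP; lia.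
Qed.

Lemma rank_nonedge a b : a != b -> ~~ edge a b -> exists t, rank t a < rank t b.
Proof.
move=> ab Nab.
have [_ _ a0 al] := melon_nthP (path_of a).
have [_ _ b0 bl] := melon_nthP (path_of b).
have := long_len (path_of a); have := long_len (path_of b) => b3 a3.
have := pos_le a; have := pos_le b; have := nth_pos a; have := nth_pos b.
move=> nb na lb la.
have Nba: ~~ edge b a by rewrite edge_sym.
have Nstep i p q x y : nth z (E i) p = x -> nth z (E i) q = y ->
    ~~ edge x y -> p < len i -> q != p.+1.
  by move=> <- <- /negP Nxy pi; apply/eqP => qE; apply: Nxy; rewrite qE coord_edge.
apply: rank_coord_nonedge => // [q0|pl|eij].
- have bz: b = z by rewrite -nb q0.
  have p0: pos a != 0.
    by apply: contra_neq ab => p0; rewrite bz -na p0.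
  have : pos a != 1 by apply: (Nstep _ _ _ b a _ na) => //; rewrite ?bz //; lia.
  lia.
- have az': a = z' by rewrite -na pl.
  have ql: pos b != len (path_of b).
    by apply: contra_neq ab => ql; rewrite az' -nb ql.
  have : len (path_of b) != (pos b).+1.
    by apply: (Nstep _ _ _ b a nb) => //; rewrite ?az' //; lia.
  lia.
- have pq: pos a != pos b.
    by apply: contra_neq ab => pq; rewrite -na -nb pq eij.
  rewrite -eij in nb lb.
  have := Nstep _ _ _ _ _ na nb Nab; have := Nstep _ _ _ _ _ nb na Nba.
  lia.
Qed.

Lemma odd_melon_perm_representable3 : perm_representable G 3.
Proof. exact: (perm_representable_ranks rank_edge rank_nonedge). Qed.

End Melon.

Theorem theorem5 (Mc : sgraph) (z z' : Mc) (m : nat) (E : 'I_m -> seq Mc)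
    (melon_Mc : melon z z' E) (comp_Mc : comparability Mc)
    (odd_E : forall i, odd (path_length (E i)))
    (long_E : forall i, 3 <= path_length (E i)) :
  exists k, perm_rep_number Mc k /\ k <= 3.
Proof.
apply: perm_rep_number_le => //.
exact: odd_melon_perm_representable3 melon_Mc odd_E long_E.
Qed.
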